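(* Let $n\ge2$, let $F_1,\dots,F_n$ be one-dimensional cdf's, and let $\xi_1,\dots,\xi_n$ be independent random variables with cdf's $F_1,\dots,F_n$. Let $X_1,\dots,X_n$ be random variables whose joint distribution is absolutely continuous with respect to the product measure $dF_1\cdots dF_n$. Then $X_1,\dots,X_n$ have one-dimensional cdf's $F_1,\dots,F_n$ (i.e. $P(X_k\le x)=F_k(x)$ for all $x\in\mathbf R$, $k=1,\dots,n$) if and only if there exists $U_n\in\mathcal G_n$ such that for any Borel measurable function $f:\mathbf R^n\to\mathbf R$ for which the expectations exist $$Ef(X_1,\dots,X_n)=E\big[f(\xi_1,\dots,\xi_n)\big(1+U_n(\xi_1,\dots,\xi_n)\big)\big].$$
   Context: $\mathcal G_n$ denotes the class of all sums of $U$-statistics of the form $$U_n(\xi_1,\dots,\xi_n)=\sum_{c=2}^n\sum_{1\le i_1<\dots<i_c\le n}g_{i_1,\dots,i_c}(\xi_{i_1},\dots,\xi_{i_c}),$$ where $g_{i_1,\dots,i_c}:\mathbf R^c\to\mathbf R$ are Borel measurable functions satisfying: (A1) $E|g_{i_1,\dots,i_c}(\xi_{i_1},\dots,\xi_{i_c})|<\infty$; (A2) $E\big(g_{i_1,\dots,i_c}(\xi_{i_1},\dots,\xi_{i_c})\,\big|\,\xi_{i_1},\dots,\xi_{i_{k-1}},\xi_{i_{k+1}},\dots,\xi_{i_c}\big)=0$ (a.s.) for all $k=1,\dots,c$; both for all $1\le i_1<\dots<i_c\le n$, $c=2,\dots,n$; and (A3) $U_n(\xi_1,\dots,\xi_n)\ge-1$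 (a.s.). *)

(* Defs.v *)
From HB Require Import structures.
From mathcomp Require Import all_boot all_order all_algebra.
From mathcomp Require Import all_classical all_reals all_analysis.

Set Implicit Arguments.
Unset Strict Implicit.
Unset Printing Implicit Defensive.

Import Order.TTheory GRing.Theory Num.Theory.
Import numFieldNormedType.Exports.

Local Open Scope classical_set_scope.
Local Open Scope ring_scope.

(* R^n is [n.-tuple R] with the library's measurable structure, i.e. the
   sigma-algebra generated by the coordinate maps, which is the Borel one. *)

Section product_probability.
Context {R : realType}.
Local Notation mR := (measurableTypeR R).

Definition cons_pair n (x : mR * n.-tuple mR) : n.+1.-tuple mR :=
  [tuple of x.1 :: x.2].

Lemma measurable_cons_pair n : measurable_fun setT (@cons_pair n).
Proof. exact: measurable_cons. Qed.

HB.instance Definition _ n :=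
  isMeasurableFun.Build _ _ _ _ (@cons_pair n) (@measurable_cons_pair n).

Fixpoint product_probability n :
    ('I_n -> probability mR R) -> probability (n.-tuple mR) R :=
  match n with
  | 0 => fun=> \d_([tuple] : 0.-tuple mR)
  | n'.+1 => fun mu => distribution
      (mu ord0 \x product_probability (fun i => mu (lift ord0 i)))%E
      (@cons_pair n')
  end.

Lemma measurable_box n (A : 'I_n -> set mR) :
  (forall i, measurable (A i)) ->
  measurable [set x : n.-tuple mR | forall i, A i (tnth x i)].
Proof.
move=> mA.
have -> : [set x : n.-tuple mR | forall i, A i (tnth x i)] =
    \bigcap_(i in [set: 'I_n]) ((@tnth _ mR ^~ i) @^-1` A i).
  by apply/seteqP; split => x /= h i => [_|]; exact: h.
apply: fin_bigcap_measurable => // i _; rewrite -[X in measurable X]setTI.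
exact: measurable_tnth.
Qed.

Lemma product_probabilityE n (mu : 'I_n -> probability mR R)
    (A : 'I_n -> set mR) : (forall i, measurable (A i)) ->
  product_probability mu [set x | forall i, A i (tnth x i)] =
  (\prod_(i < n) mu i (A i))%E.
Proof.
elim: n => [|n IH] in mu A *; move=> mA.
  by rewrite big_ord0 /= diracE mem_set// => -[].
rewrite big_ord_recl /= /distribution /pushforward.
have -> : @cons_pair n @^-1` [set x | forall i, A i (tnth x i)] =
    A ord0 `*` [set x | forall i, A (lift ord0 i) (tnth x i)].
  apply/seteqP; split=> [[a x] /= h|[a x] /= [a0 h] i].
    split; first by have := h ord0; rewrite (tnth_nth a).
    by move=> i; have := h (lift ord0 i); rewrite tnthS.
  case: (unliftP ord0 i) => [j|] ->; first by rewrite tnthS; exact: h.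
  by rewrite (tnth_nth a).
rewrite [LHS]product_measure1E//; last first.
  exact: (@measurable_box n (fun i => A (lift ord0 i))).
by congr (_ * _)%E; exact: (IH _ (fun i => A (lift ord0 i))).
Qed.

End product_probability.

Section random_vectors.
Context {d} {T : measurableType d} {R : realType}.

Definition vec n (X : 'I_n -> T -> R) (w : T) : n.-tuple R :=
  [tuple X i w | i < n].

Definition mutually_independent n (P : probability T R)
    (X : 'I_n -> {RV P >-> R}) :=
  forall (J : {set 'I_n}) (B : 'I_n -> set R),
    (forall i, i \in J -> measurable (B i)) ->
    P (\bigcap_(i in [set` J]) (X i @^-1` B i)) =
    (\prod_(i in J) P (X i @^-1` B i))%E.

(* [Y] is a version of E(Z | G). *)
Definition is_cond_expectation (P : probability T R) (G : set (set T))
    (Z Y : T -> R) :=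
  [/\ P.-integrable setT (EFin \o Z),
      P.-integrable setT (EFin \o Y),
      (forall B : set R, measurable B -> G (Y @^-1` B)) &
      forall A, G A ->
        (\int[P]_(w in A) (Y w)%:E = \int[P]_(w in A) (Z w)%:E)%E].

(* Existence in the extended sense: E Y may be infinite, but is not the
   indeterminate +oo - oo. *)
Definition expectation_exists (P : probability T R) (Y : T -> R) :=
  ('E_P[Y^\+] < +oo)%E \/ ('E_P[Y^\-] < +oo)%E.

End random_vectors.

Definition increasing n c (i : c.-tuple 'I_n) : bool :=
  sorted ltn [seq val j | j <- i].

(* The argument [c : nat] of a kernel is the number of its variables; its value
   at [i : c.-tuple 'I_n] only matters for [2 <= c <= n] and [increasing i]. *)
Definition kernels (R : realType) (n : nat) :=
  forall c, c.-tuple 'I_n -> c.-tuple R -> R.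

Definition Ustat_sum (R : realType) n (g : kernels R n) (x : n.-tuple R) : R :=
  \sum_(2 <= c < n.+1) \sum_(i : c.-tuple 'I_n | increasing i)
    g c i [tuple tnth x (tnth i j) | j < c].

(* The family [fun j : 'I_c.-1 => xi (tnth i (lift k j))] lists
   xi_(i_1), ..., xi_(i_c) with xi_(i_k) omitted. *)
Definition calG d (T : measurableType d) (R : realType) (P : probability T R)
    n (xi : 'I_n -> {RV P >-> R}) : set (n.-tuple R -> R) :=
  [set U | exists2 g : kernels R n,
    (forall c (i : c.-tuple 'I_n), (2 <= c <= n)%N -> increasing i ->
      let Z := g c i \o vec (fun j => xi (tnth i j)) in
      [/\ measurable_fun setT (g c i),
          P.-integrable setT (EFin \o Z) &
          forall k : 'I_c,
            is_cond_expectation P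
              (g_sigma_preimage (fun j : 'I_c.-1 => xi (tnth i (lift k j))))
              Z (cst 0)]) /\
    (\forall w \ae P, -1 <= U (vec xi w)) &
    U = Ustat_sum g].

(* Main.v *)
Require Import Defs.
From HB Require Import structures.
From mathcomp Require Import all_boot all_order all_algebra.
From mathcomp Require Import all_classical all_reals all_analysis.
From mathcomp Require Import measurable_realfun.

(** Let M be the joint law of xi_1, ..., xi_n, a product measure, and h the
    density of the law of (X_1, ..., X_n) with respect to M. For a set S of
    indices let E_S h integrate out, against an independent copy of xi, the
    coordinates outside S. The kernels are the Hoeffding projections
      g_S = sum_{A subset S} (-1)^|S \ A| E_A h,
    and Moebius inversion gives sum_S g_S = h pointwise. Here g_emptyset = 1,
    and g_{k} = 0 a.s. because X_k and xi_k have the same law, so the terms of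
    order at least 2 add up to h - 1. Conversely, a degenerate kernel of order
    at least 2 integrates to 0 over every event {xi_k in B}: if xi_k is one of
    its arguments, condition on all of them but another one; otherwise use
    independence. Applying the representation to the indicator of {x_k in B}
    then identifies the law of X_k. *)

Set Implicit Arguments.
Unset Strict Implicit.
Unset Printing Implicit Defensive.

Import Order.TTheory GRing.Theory Num.Theory.
Import numFieldNormedType.Exports.

Local Open Scope classical_set_scope.
Local Open Scope ring_scope.

(** * Sums over subsets *)

(* Pairs each [A] not containing [k] with [k |: A]. *)
Lemma big_toggle (V : zmodType) (I : finType) (k : I) (Q : pred {set I})
    (f : {set I} -> V) :
  (forall A : {set I}, k \notin A -> Q (k |: A)%SET = Q A) ->
  (forall A : {set I}, k \notin A -> Q A -> f (k |: A)%SET = - f A) ->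
  \sum_(A : {set I} | Q A) f A = 0.
Proof.
move=> Qk fk; rewrite (bigID (fun A : {set I} => k \in A)) /=.
rewrite (reindex_onto (fun A : {set I} => k |: A)%SET (fun A : {set I} => A :\ k)%SET) /=; last first.
  by move=> A /andP[_ kA]; rewrite finset.setD1K.
rewrite (eq_bigl (fun A : {set I} => Q A && (k \notin A))) => [|A].
  rewrite -big_split big1 // => A /andP[QA kA] /=.
  by rewrite fk// addNr.
rewrite finset.setU11 andbT; have [kA|kA] /= := boolP (k \in A).
  rewrite andbF; apply/negbTE/negP => /andP[_ /eqP E].
  by move: kA; rewrite -E !inE eqxx.
by rewrite finset.setU1K// eqxx Qk.
Qed.

(** If some [k] is missing from [A], adding or removing [k] pairs the supersets of [A] with opposite
    signs; if [A] is full, its only superset is itself. *)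
Lemma sum_superset_sign (I : finType) (R : nzRingType) (A : {set I}) :
  \sum_(S : {set I} | A \subset S) (-1) ^+ #|S :\: A|
  = (A == [set: I]%SET)%:R :> R.
Proof.
have [->|] := eqVneq A [set: I]%SET.
  rewrite (big_pred1 [set: I]%SET) => [|S]; first by rewrite finset.setDv cards0.
  by rewrite /= finset.subTset.
rewrite -finset.subTset => /subsetPn[k _ kA].
apply: (@big_toggle _ _ k) => S kS.
  apply/idP/idP => [AS|AS]; last exact: (fintype.subset_trans AS (finset.subsetUr _ _)).
  by rewrite -(finset.setU1K kS) finset.subsetD1 AS.
move=> _; rewrite finset.setDUl.
have -> : ([set k] :\: A = [set k])%SET.
  by apply/finset.setP => x; rewrite !inE; case: eqP => [->|]; rewrite ?kA ?andbF.
by rewrite cardsU1 inE (negbTE kS) andbF exprS mulN1r.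
Qed.

(** Once the two sums are exchanged, the coefficient of [a A] is the alternating sum over the
    supersets of [A], which vanishes unless [A] is full. *)
Lemma moebius_inversion (I : finType) (R : nzRingType) (a : {set I} -> R) :
  \sum_(S : {set I}) \sum_(A : {set I} | A \subset S) (-1) ^+ #|S :\: A| * a A
  = a [set: I]%SET.
Proof.
rewrite (exchange_big_dep xpredT)//=.
under eq_bigr do rewrite -mulr_suml sum_superset_sign.
rewrite (bigD1 [set: I]%SET)//= eqxx mul1r big1 ?addr0// => A /negbTE ->.
by rewrite mul0r.
Qed.

Lemma sorted_enum_set n (S : {set 'I_n}) : sorted ltn [seq val j | j <- enum S].
Proof.
rewrite -[enum _](eq_filter (mem_enum _)).
rewrite -(eq_filter (mem_map val_inj _)) -filter_map.
by rewrite (sorted_filter ltn_trans) // unlock val_ord_enum iota_ltn_sorted.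
Qed.

(** Increasing [c]-tuples correspond to sets of cardinality [c]. This passes from the indexing of
    U-statistics to that of Hoeffding projections. *)
Lemma sum_increasing (V : nmodType) n (G : {set 'I_n} -> V) :
  \sum_(2 <= c < n.+1) \sum_(i : c.-tuple 'I_n | increasing i)
    G [set x in tval i]%SET = \sum_(S : {set 'I_n} | (1 < #|S|)%N) G S.
Proof.
rewrite big_geq_mkord /=.
have cn (S : {set 'I_n}) : (#|S| < n.+1)%N.
  by rewrite ltnS -[leqRHS](card_ord n) max_card.
rewrite [RHS](partition_big (fun S : {set 'I_n} => Ordinal (cn S))
  (fun c => 1 < c)%N)//=.
apply: eq_bigr => c c1.
rewrite (partition_big (fun i : c.-tuple 'I_n => [set x in tval i]%SET)
  (fun S : {set 'I_n} => (1 < #|S|)%N && (Ordinal (cn S) == c))) /=.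
  apply: eq_bigr => S /andP[S1 /eqP Sc].
  have eS : size (enum S) == c by rewrite -cardE -Sc.
  (* Strictly sorted lists with the same members are equal, so [enum S] is the only increasing tuple
     with underlying set [S]. *)
  rewrite (big_pred1 (Tuple eS)) => [|i] /=.
    by congr G; apply/finset.setP => x; rewrite inE mem_enum.
  apply/andP/eqP => [[ii /eqP iS]|->].
    apply/val_inj; rewrite /= -iS; apply: (inj_map val_inj).
    apply: (irr_sorted_eq ltn_trans ltnn) => //.
      exact: sorted_enum_set.
    by move=> y; apply/mapP/mapP => -[x xi ->]; exists x; rewrite // mem_enum inE in xi *.
  split=> //; last by apply/eqP/finset.setP => x; rewrite inE mem_enum.
  exact: sorted_enum_set.
move=> i ii.
have ci : #|[set x in tval i]%SET| = c.
  rewrite cardsE (card_uniqP _) ?size_tuple // -(map_inj_uniq val_inj).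
  exact: (sorted_uniq ltn_trans ltnn).
by apply/andP; split; [rewrite ci|apply/eqP/val_inj].
Qed.

(** * Product measures and exchange of coordinates *)

(** Uniqueness on a pi-system; the constant sequence [setT] is an admissible exhaustion since it
    lies in [G] and has finite mass. *)
Lemma pi_system_measure_unique d (T : measurableType d) (R : realType)
    (G : set (set T)) (m1 m2 : probability T R) :
  G `<=` measurable -> measurable `<=` <<s G >> -> setI_closed G -> G setT ->
  (forall A, G A -> m1 A = m2 A) ->
  forall A, measurable A -> m1 A = m2 A.
Proof.
move=> Gm mG GI GT m12; apply: (measure_unique G (fun=> setT)) => //.
- by apply/seteqP; split=> //; apply: smallest_sub => //;
    exact: sigma_algebra_measurable.
- by rewrite bigcup_const.
- by move=> _; apply: le_lt_trans (probability_le1 m1 measurableT) (ltry _).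
Qed.

Section tuples.
Context {R : realType}.
Local Notation mR := (measurableTypeR R).

Definition box n (A : 'I_n -> set mR) : set (n.-tuple mR) :=
  [set x | forall i, A i (tnth x i)].

Lemma boxT n : box (fun=> setT) = [set: n.-tuple mR].
Proof. by apply/seteqP; split. Qed.

Lemma boxI n (A B : 'I_n -> set mR) :
  box A `&` box B = box (fun i => A i `&` B i).
Proof.
apply/seteqP; split=> x; first by move=> [hA hB] i; split; [exact: hA|exact: hB].
by move=> h; split=> i; case: (h i).
Qed.

Lemma coordinate_box n (k : 'I_n) (B : set mR) :
  (tnth (T := mR)) ^~ k @^-1` B = box (fun i => if i == k then B else setT).
Proof.
apply/seteqP; split => x /=; last by move=> /(_ k); rewrite eqxx.
by move=> Bx i; case: eqP => [->|].
Qed.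

Lemma measurable_if_setT n (k : 'I_n) (B : set mR) : measurable B ->
  forall i, measurable (if i == k then B else setT).
Proof. by move=> mB i; case: ifP. Qed.

(** Boxes form a pi-system, and they generate: the preimage of a Borel set under a coordinate is a
    box whose other sides are [setT]. *)
Lemma tuple_measure_unique n (m1 m2 : probability (n.-tuple mR) R) :
  (forall A : 'I_n -> set mR, (forall i, measurable (A i)) ->
    m1 (box A) = m2 (box A)) ->
  forall A, measurable A -> m1 A = m2 A.
Proof.
move=> m12; pose G := [set X | exists2 A : 'I_n -> set mR,
  (forall i, measurable (A i)) & X = box A].
apply: (@pi_system_measure_unique _ _ _ G).
- by move=> _ [A mA ->]; exact: measurable_box.
- apply: smallest_sub; first exact: smallest_sigma_algebra.
  rewrite -bigcup_seq => X [k _ [B mB]]; rewrite setTI => <-.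
  apply: sub_sigma_algebra; rewrite coordinate_box.
  by exists (fun i => if i == k then B else setT); first exact: measurable_if_setT.
- move=> _ _ [A mA ->] [B mB ->]; rewrite boxI; exists (fun i => A i `&` B i) => //.
  by move=> i; exact: measurableI.
- by exists (fun=> setT); [move=> i; exact: measurableT|rewrite boxT].
- by move=> _ [A mA ->]; exact: m12.
Qed.

Lemma pair_measure_unique n (m1 m2 : probability (n.-tuple mR * n.-tuple mR)%type R) :
  (forall A B : 'I_n -> set mR, (forall i, measurable (A i)) ->
    (forall i, measurable (B i)) -> m1 (box A `*` box B) = m2 (box A `*` box B)) ->
  forall A, measurable A -> m1 A = m2 A.
Proof.
move=> m12; pose G := [set X | exists A B : 'I_n -> set mR,
  [/\ forall i, measurable (A i), forall i, measurable (B i)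
    & X = box A `*` box B]].
apply: (@pi_system_measure_unique _ _ _ G).
- by move=> _ [A [B [mA mB ->]]]; apply: measurableX; exact: measurable_box.
- move=> A mA.
  (* The coordinates of the identity are measurable for [<<s G>>]. *)
  have mid : measurable_fun setT
      (idfun : g_sigma_algebraType G -> (n.-tuple mR * n.-tuple mR)%type).
    apply/measurable_fun_pairP; split; apply/measurable_fun_tnthP => k _ Y mY;
      rewrite setTI; apply: sub_sigma_algebra.
      exists (fun i => if i == k then Y else setT), (fun=> setT); split => //.
        exact: measurable_if_setT.
      by rewrite boxT -coordinate_box; apply/seteqP; split=> x //= -[].
    exists (fun=> setT), (fun i => if i == k then Y else setT); split => //.
      exact: measurable_if_setT.
    by rewrite boxT -coordinate_box; apply/seteqP; split=> x //= -[].
  by have := mid measurableT _ mA; rewrite setTI.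
- move=> _ _ [A [B [mA mB ->]]] [A' [B' [mA' mB' ->]]].
  exists (fun i => A i `&` A' i), (fun i => B i `&` B' i).
  split; [by move=> i; exact: measurableI..|].
  by rewrite -!boxI setXI.
- by exists (fun=> setT), (fun=> setT); rewrite boxT setXTT.
- by move=> _ [A [B [mA mB ->]]]; exact: m12.
Qed.

(** The second member of the pair serves as an independent copy: integrating it out of [h (mix S z)]
    averages [h] over the coordinates outside [S]. *)
Definition mix n (S : {set 'I_n}) (z : n.-tuple mR * n.-tuple mR) :
    n.-tuple mR :=
  [tuple if i \in S then tnth z.1 i else tnth z.2 i | i < n].

(* Swaps the coordinates in [C] between the two members of the pair. *)
Definition exchange n (C : {set 'I_n}) (z : n.-tuple mR * n.-tuple mR) :=
  (mix (~: C)%SET z, mix C z).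

Lemma measurable_mix n (S : {set 'I_n}) : measurable_fun setT (mix S).
Proof.
apply/measurable_fun_tnthP => i.
rewrite [X in measurable_fun _ X](_ : _ =
  (fun z => if i \in S then tnth z.1 i else tnth z.2 i)); last first.
  by apply/funext => z /=; rewrite tnth_mktuple.
case: (i \in S).
- exact: (measurableT_comp (measurable_tnth i) measurable_fst).
- exact: (measurableT_comp (measurable_tnth i) measurable_snd).
Qed.

HB.instance Definition _ n (S : {set 'I_n}) :=
  isMeasurableFun.Build _ _ _ _ (mix S) (measurable_mix S).

Lemma measurable_exchange n (C : {set 'I_n}) : measurable_fun setT (exchange C).
Proof. by apply: measurable_fun_pair; exact: measurable_mix. Qed.

HB.instance Definition _ n (C : {set 'I_n}) :=
  isMeasurableFun.Build _ _ _ _ (exchange C) (measurable_exchange C).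

Section law.
Variables (n : nat) (mu : 'I_n -> probability mR R).
Local Notation M := (product_probability mu).

Lemma product_probability_box (A : 'I_n -> set mR) :
  (forall i, measurable (A i)) -> M (box A) = (\prod_(i < n) mu i (A i))%E.
Proof. exact: product_probabilityE. Qed.

(** It suffices to treat products of two boxes. There the exchange only swaps the factors
    [mu i (A i)] and [mu i (B i)] for [i] in [C], because both copies have the same marginals. *)
Lemma exchange_invariant (C : {set 'I_n}) D : measurable D ->
  (M \x M)%E (exchange C @^-1` D) = (M \x M)%E D.
Proof.
move: D; apply: (@pair_measure_unique n (distribution (M \x M)%E (exchange C))).
move=> A B mA mB.
have E : exchange C @^-1` (box A `*` box B) =
    box (fun i => if i \in C then B i else A i) `*`
    box (fun i => if i \in C then A i else B i).
  apply/seteqP; split => -[x y]/=.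
    move=> -[hA hB]; split=> i; move: (hA i) (hB i);
      by rewrite !tnth_mktuple ?finset.in_setC; case: (i \in C).
  move=> -[hA hB]; split=> i; move: (hA i) (hB i);
    by rewrite !tnth_mktuple ?finset.in_setC; case: (i \in C).
rewrite -[LHS]/((M \x M)%E (exchange C @^-1` (box A `*` box B))) E.
rewrite -[RHS]/((M \x M)%E (box A `*` box B)).
rewrite !product_measure1E//; try exact: measurable_box;
  try by apply: measurable_box => i; case: ifP.
rewrite [X in (X * _)%E = _]product_probability_box; last by move=> i; case: ifP.
rewrite [X in (_ * X)%E = _]product_probability_box; last by move=> i; case: ifP.
rewrite [X in _ = (X * _)%E]product_probability_box//.
rewrite [X in _ = (_ * X)%E]product_probability_box//.
rewrite -!big_split/=; apply: eq_bigr => i _.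
by case: ifP => // _; rewrite muleC.
Qed.

(** [mix S] is the first component of [exchange (~: S)], which preserves the law of the pair. *)
Lemma mix_law (S : {set 'I_n}) D : measurable D ->
  (M \x M)%E (mix S @^-1` D) = M D.
Proof.
move=> mD; have -> : mix S @^-1` D = exchange (~: S)%SET @^-1` (D `*` setT).
  by apply/seteqP; split => z /=; rewrite finset.setCK// => -[].
rewrite exchange_invariant; last exact: measurableX.
rewrite product_measure1E//.
by rewrite [X in (_ * X)%E](_ : _ = 1%E) ?mule1//; exact: probability_setT.
Qed.

End law.
End tuples.

(** * Laws of random vectors and their cdf's *)

Section random_vector_law.
Context d (T : measurableType d) (R : realType).
Local Notation mR := (measurableTypeR R).

(* [R] and [measurableTypeR R] have the same measurable sets but different
   displays; [mvec] is [vec] seen as a map to the carrier of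
   [product_probability]. *)
Definition mvec n (X : 'I_n -> {mfun T >-> R}) : T -> n.-tuple mR := vec X.

Lemma measurable_mvec n (X : 'I_n -> {mfun T >-> R}) :
  measurable_fun setT (mvec X).
Proof.
apply/measurable_fun_tnthP => i.
rewrite [Y in measurable_fun _ Y](_ : _ = (X i : T -> mR)).
  exact: (@measurable_funPT _ _ _ _ (X i)).
by apply/funext => w; rewrite /= tnth_mktuple.
Qed.

HB.instance Definition _ n (X : 'I_n -> {mfun T >-> R}) :=
  isMeasurableFun.Build _ _ _ _ (mvec X) (measurable_mvec X).

(** Independence over the full index set gives the product formula on boxes, and boxes determine the
    law. *)
Lemma independent_law (P : probability T R) n (xi : 'I_n -> {RV P >-> R})
    (mu : 'I_n -> probability mR R) : mutually_independent xi ->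
  (forall i A, measurable A -> P (xi i @^-1` A) = mu i A) ->
  forall A, measurable A ->
    distribution P (mvec xi) A = product_probability mu A.
Proof.
move=> indep lawxi; apply: tuple_measure_unique => A mA.
rewrite [RHS]product_probabilityE//.
rewrite (eq_bigr (fun i => P (xi i @^-1` A i))); last by move=> i _; rewrite lawxi//; exact: mA.
have := indep [set: 'I_n]%SET A (fun i _ => mA i).
rewrite big_mkcond/= (eq_bigr (fun i => P (xi i @^-1` A i)))//; last first.
  by move=> i _; rewrite finset.in_setT.
move=> <-; congr (P _); apply/seteqP; split=> w /= h i.
  by have := h i; rewrite tnth_mktuple.
by rewrite tnth_mktuple; apply: h; rewrite /= finset.in_setT.
Qed.

End random_vector_law.

(** The cdf fixes the mass [F b - F a] of each half-open interval from [a] to [b], and these masses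
    determine the measure. *)
Lemma lebesgue_stieltjes_cdf_unique (R : realType)
    (F : cumulativeBounded (0 : R) (1 : R))
    (P : probability (measurableTypeR R) R) :
  (forall r, P `]-oo, r]%classic = (F r)%:E) ->
  forall A, measurable A -> P A = lebesgue_stieltjes_measure F A.
Proof.
move=> PF A mA; apply/esym.
apply: lebesgue_stieltjes_measure_unique => [I [[a b]]/= _ <- | //].
rewrite /lebesgue_stieltjes_measure /measure_extension/=.
rewrite measurable_mu_extE/=; last exact: is_ocitv.
have [ab | ba] := leP a b; last first.
  by rewrite set_itv_ge ?wlength0 ?measure0// bnd_simp -leNgt ltW.
rewrite wlength_itv_bnd// EFinB -!PF.
have -> : `]a, b]%classic = (`]-oo, b] `\` `]-oo, a])%classic.
  by rewrite -[RHS]setCK setCD setCitvl setUC -[LHS]setCK setCitv.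
rewrite measureD ?setIidr//; first exact: subset_itvl.
by rewrite -ge0_fin_numE// fin_num_measure.
Qed.

(** * Integrating out coordinates *)

Section transfer.
Context d d' (X : measurableType d) (Y : measurableType d') (R : realType).
Variables (m : {measure set X -> \bar R}) (nu : {measure set Y -> \bar R}).
Variable phi : {mfun X >-> Y}.
Hypothesis law : forall A, measurable A -> m (phi @^-1` A) = nu A.

Let law_distribution A : measurable A -> pushforward m phi A = nu A.
Proof. exact: law. Qed.

Lemma ge0_integral_law (f : Y -> \bar R) (D : set Y) : measurable D ->
  measurable_fun setT f -> (forall y, 0 <= f y)%E ->
  (\int[m]_(x in phi @^-1` D) f (phi x) = \int[nu]_(y in D) f y)%E.
Proof.
move=> mD mf f0; rewrite -[LHS](@ge0_integral_pushforward _ _ _ _ _ phi)//.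
- by apply: eq_measure_integral => A mA _; exact: law_distribution.
- exact: measurable_funTS.
Qed.

Lemma integrable_law (f : Y -> \bar R) : nu.-integrable setT f ->
  m.-integrable setT (f \o phi).
Proof.
move=> /integrableP[mf foo]; apply/integrableP; split.
  exact: measurableT_comp.
have := @ge0_integral_law (fun y => `|f y|%E) setT measurableT.
by rewrite preimage_setT => ->//; exact: measurableT_comp.
Qed.

Lemma integrable_law_inv (f : Y -> \bar R) : measurable_fun setT f ->
  m.-integrable setT (f \o phi) -> nu.-integrable setT f.
Proof.
move=> mf /integrableP[_ foo]; apply/integrableP; split => //.
have := @ge0_integral_law (fun y => `|f y|%E) setT measurableT.
by rewrite preimage_setT => <-//; exact: measurableT_comp.
Qed.

(** Positive and negative parts are transferred separately, so the identity also covers integrals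
    with infinite values. *)
Lemma integral_law (f : Y -> \bar R) (D : set Y) : measurable D ->
  measurable_fun setT f ->
  (\int[m]_(x in phi @^-1` D) f (phi x) = \int[nu]_(y in D) f y)%E.
Proof.
move=> mD mf; rewrite integralE [RHS]integralE; congr (_ - _)%E.
- rewrite (funepos_comp f phi).
  exact: (ge0_integral_law mD (measurable_funepos mf) (funepos_ge0 f)).
- rewrite (funeneg_comp f phi).
  exact: (ge0_integral_law mD (measurable_funeneg mf) (funeneg_ge0 f)).
Qed.

Lemma ae_law (p : Y -> Prop) : {ae nu, forall y, p y} ->
  {ae m, forall x, p (phi x)}.
Proof.
move=> [N [mN N0 pN]]; exists (phi @^-1` N); split.
- by rewrite -[X in measurable X]setTI; exact: measurable_funP.
- by rewrite law.
- by move=> x /= px; exact: pN.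
Qed.

End transfer.

Section conditional_expectation.
Context {R : realType}.
Local Notation mR := (measurableTypeR R).
Variable n : nat.
Local Notation Omega := (n.-tuple mR).

(** With [U := Prop] this applies to events: membership in the set is then decided by the
    coordinates in [S]. *)
Definition depends_on (S : {set 'I_n}) U (f : Omega -> U) :=
  forall x y, (forall i, i \in S -> tnth x i = tnth y i) -> f x = f y.

Lemma depends_onW (S S' : {set 'I_n}) U (f : Omega -> U) :
  S \subset S' -> depends_on S f -> depends_on S' f.
Proof. by move=> /fintype.subsetP SS' Sf x y xy; apply: Sf => i /SS'; exact: xy. Qed.

Lemma tnth_mix (S : {set 'I_n}) (z : Omega * Omega) i :
  tnth (mix S z) i = if i \in S then tnth z.1 i else tnth z.2 i.
Proof. by rewrite tnth_mktuple. Qed.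

Lemma mix_depends_on (S : {set 'I_n}) U (f : Omega -> U) z : depends_on S f ->
  f (mix S z) = f z.1.
Proof. by apply=> i iS; rewrite tnth_mix iS. Qed.

Lemma mix_exchange (A : {set 'I_n}) k (z : Omega * Omega) : k \in A ->
  mix A (exchange [set k]%SET z) = mix (A :\ k)%SET z.
Proof.
move=> kA; apply: eq_from_tnth => i.
rewrite !tnth_mix/= finset.in_setC finset.in_setD1 finset.in_set1.
by have [->|_] := eqVneq i k; rewrite ?kA//.
Qed.

Variable mu : 'I_n -> probability mR R.
Local Notation M := (product_probability mu).

(** A version of the conditional expectation of [h] given the coordinates in [S]. An infinite
    partial integral is read as 0 by [fine]; for integrable [h] this happens only on a null set. *)
Definition cexp (S : {set 'I_n}) (h : Omega -> R) (x : Omega) : R :=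
  fine (\int[M]_y (h (mix S (x, y)))%:E)%E.

Lemma cexp_depends_on (S : {set 'I_n}) h : depends_on S (cexp S h).
Proof.
move=> x x' xx'; congr fine; apply: eq_integral => y _; congr (h _)%:E.
by apply: eq_from_tnth => i; rewrite !tnth_mix/=; case: ifP => // /xx'.
Qed.

Lemma cexpT h : cexp [set: 'I_n]%SET h = h.
Proof.
apply/funext => x; rewrite /cexp.
rewrite (eq_integral (cst (h x)%:E)) => [|y _]; last first.
  congr (h _)%:E; apply: eq_from_tnth => i.
  by rewrite tnth_mix finset.in_setT.
by rewrite integral_cst// [X in (_ * X)%E]probability_setT mule1.
Qed.

Lemma cexp0 h x : cexp finset.set0 h x = fine (\int[M]_y (h y)%:E)%E.
Proof.
congr fine; apply: eq_integral => y _; congr (h _)%:E.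
by apply: eq_from_tnth => i; rewrite tnth_mix finset.in_set0.
Qed.

Section integrable.
Variable h : Omega -> R.
Hypothesis hi : M.-integrable setT (EFin \o h).

Let hmix (S : {set 'I_n}) := EFin \o h \o mix S.

Lemma integrable_mix (S : {set 'I_n}) : (M \x M)%E.-integrable setT (hmix S).
Proof. exact: (integrable_law (@mix_law R n mu S) hi). Qed.

(** By Fubini almost every section is integrable, and there [fine] loses nothing. *)
Lemma cexp_ae (S : {set 'I_n}) :
  {ae M, forall x, fubini_F M (hmix S) x = (cexp S h x)%:E}.
Proof.
have := ae_integrable1 (integrable_mix S); apply: filterS => x hx.
by rewrite fineK//; apply: integrable_fin_num.
Qed.

Lemma measurable_cexp (S : {set 'I_n}) : measurable_fun setT (cexp S h).
Proof.
apply: (@measurableT_comp _ _ _ _ _ _ fine) => //.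
exact: measurable_int (integrable_fubini_F (integrable_mix S)).
Qed.

Lemma integrable_cexp (S : {set 'I_n}) : M.-integrable setT (EFin \o cexp S h).
Proof.
apply: le_integrable (integrable_fubini_F (integrable_mix S)) => //.
  by apply/measurable_EFinP; exact: measurable_cexp.
have fine_le (u : \bar R) : (`|(fine u)%:E| <= `|u|)%E.
  by case: u => [r| |]; rewrite ?lexx//= normr0 leey.
by move=> x _; exact: fine_le.
Qed.

(** The event constrains only the first copy, so restricting to it commutes with integrating out the
    second; Fubini does the rest. *)
Lemma integral_cexp (S : {set 'I_n}) B : measurable B ->
  (\int[M]_(x in B) (cexp S h x)%:E =
   \int[M \x M]_(z in fst @^-1` B) (h (mix S z))%:E)%E.
Proof.
move=> mB; have mfB : measurable (fst @^-1` B : set (Omega * Omega)).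
  by rewrite -[X in measurable X]setTI; exact: measurable_fst.
rewrite integral_mkcond [RHS]integral_mkcond -integral12_prod_meas1; last first.
  apply: (integrable_mkcond _ mfB).1.
  by apply: (integrableS measurableT) => //; exact: integrable_mix.
apply: ae_eq_integral => //.
- apply/(measurable_restrictT _ _).1 => //; apply: measurable_funTS.
  by apply/measurable_EFinP; exact: measurable_cexp.
- apply: (measurable_int M); apply: integrable_fubini_F.
  apply: (integrable_mkcond _ mfB).1.
  by apply: (integrableS measurableT) => //; exact: integrable_mix.
- have := cexp_ae S; apply: filterS => x xE _.
  rewrite /fubini_F patchE; case: ifPn => xB.
    rewrite -xE; apply: eq_integral => y _; rewrite patchE mem_set//.
    exact: set_mem xB.
  rewrite integral0_eq// => y _; rewrite patchE memNset//= => /mem_set.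
  exact/negP.
Qed.

(** The averaging property of conditional expectation: [mix S] carries the product law to [M], and
    an event that only sees [S] cannot distinguish [mix S z] from [z.1]. *)
Lemma integral_cexp_depends_on (S : {set 'I_n}) B : measurable B ->
  depends_on S B -> (\int[M]_(x in B) (cexp S h x)%:E = \int[M]_(x in B) (h x)%:E)%E.
Proof.
move=> mB SB; rewrite integral_cexp//.
rewrite -[RHS](integral_law (@mix_law R n mu S))//; last exact: measurable_int hi.
have -> // : mix S @^-1` B = fst @^-1` B.
by apply/seteqP; split => z; rewrite /= mix_depends_on.
Qed.

(* Exchanging the [k]-th coordinates of two independent copies preserves their
   joint law and [B], and turns [mix A] into [mix (A :\ k)]. *)
Lemma integral_cexpD1 (A : {set 'I_n}) k B : k \in A -> measurable B ->
  depends_on (~: [set k])%SET B ->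
  (\int[M]_(x in B) (cexp A h x)%:E = \int[M]_(x in B) (cexp (A :\ k)%SET h x)%:E)%E.
Proof.
move=> kA mB kB; rewrite !integral_cexp//.
have mfB : measurable (fst @^-1` B : set (Omega * Omega)).
  by rewrite -[X in measurable X]setTI; exact: measurable_fst.
rewrite -[LHS](integral_law (@exchange_invariant R n mu [set k]%SET))//; last first.
  exact: measurable_int (integrable_mix A).
have -> : exchange [set k]%SET @^-1` (fst @^-1` B) = fst @^-1` B.
  by apply/seteqP; split => z; rewrite /= mix_depends_on.
by apply: eq_integral => z _; rewrite mix_exchange.
Qed.

End integrable.
End conditional_expectation.

(** * Hoeffding projections *)

Section hoeffding.
Context {R : realType}.
Local Notation mR := (measurableTypeR R).
Variable n : nat.
Local Notation Omega := (n.-tuple mR).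

Definition coordinate (k : 'I_n) (x : Omega) : mR := tnth x k.

HB.instance Definition _ (k : 'I_n) := isMeasurableFun.Build _ _ _ _
  (coordinate k) (measurable_tnth k).

Lemma coordinate_depends_on (k : 'I_n) (S : {set 'I_n}) (B : set mR) :
  k \in S -> depends_on S (coordinate k @^-1` B).
Proof. by move=> kS x y xy; rewrite /coordinate /preimage/= xy. Qed.

Lemma measurable_coordinate_preimage (k : 'I_n) (B : set mR) : measurable B ->
  measurable (coordinate k @^-1` B).
Proof. by move=> mB; rewrite -[X in measurable X]setTI; exact: measurable_tnth. Qed.

Variable mu : 'I_n -> probability mR R.
Local Notation M := (product_probability mu).

Lemma coordinate_law (k : 'I_n) (B : set mR) : measurable B ->
  M (coordinate k @^-1` B) = mu k B.
Proof.
move=> mB; rewrite coordinate_box product_probability_box; last first.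
  exact: measurable_if_setT.
rewrite (bigD1 k)//= eqxx big1 ?mule1// => i /negbTE ->.
exact: probability_setT.
Qed.

(** Independence enters through averaging: the indicator of the event times [G] keeps its total
    integral when the [k]-th coordinate is integrated out. *)
Lemma integral_independent (G : Omega -> R) (k : 'I_n) (B : set mR) :
  M.-integrable setT (EFin \o G) -> depends_on (~: [set k])%SET G ->
  measurable B ->
  (\int[M]_(x in coordinate k @^-1` B) (G x)%:E = mu k B * \int[M]_x (G x)%:E)%E.
Proof.
move=> iG kG mB; set D := coordinate k @^-1` B.
have mD : measurable D by exact: measurable_coordinate_preimage.
pose F x := (\1_D x * G x)%R.
have FE : EFin \o F = (EFin \o G) \_ D.
  apply/funext => x; rewrite /F /= patchE indicE.
  by case: (x \in D); rewrite ?mul1r ?mul0r.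
have iF : M.-integrable setT (EFin \o F).
  rewrite FE; apply: (integrable_mkcond _ mD).1.
  exact: (integrableS measurableT).
have muB : (fine (mu k B))%:E = mu k B by rewrite fineK// fin_num_measure.
(* [F] integrated over its [k]-th coordinate is [mu k B * G]. *)
have cF : cexp mu (~: [set k])%SET F = (fun x => fine (mu k B) * G x).
  apply/funext => x; rewrite /cexp.
  rewrite (eq_integral (fun y => (G x)%:E * (\1_D y)%:E)%E) => [|y _]; last first.
    rewrite /F (mix_depends_on (x, y) kG) -EFinM mulrC.
    congr (G x * _)%:E; rewrite !indicE; congr ((nat_of_bool _)%:R).
    apply: asbool_equiv_eq; rewrite /D /coordinate /preimage/=.
    by rewrite tnth_mix finset.in_setC finset.in_set1 eqxx.
  rewrite integralZl//; last exact: integrable_indic.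
  by rewrite integral_indic// setIT [X in (_ * X)%E](coordinate_law k mB) -muB -EFinM/= mulrC.
rewrite integral_mkcond -FE.
rewrite -(@integral_cexp_depends_on _ _ mu F iF (~: [set k])%SET setT)//.
rewrite cF -muB; under eq_integral do rewrite EFinM.
by rewrite integralZl.
Qed.

Definition hoeffding (S : {set 'I_n}) (h : Omega -> R) (x : Omega) : R :=
  \sum_(A : {set 'I_n} | A \subset S) (-1) ^+ #|S :\: A| * cexp mu A h x.

Lemma hoeffding_depends_on (S : {set 'I_n}) h : depends_on S (hoeffding S h).
Proof.
move=> x y xy; apply: eq_bigr => A AS; congr (_ * _).
exact: (depends_onW AS (@cexp_depends_on _ _ mu A h)).
Qed.

Lemma sum_hoeffding h x : \sum_(S : {set 'I_n}) hoeffding S h x = h x.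
Proof. by rewrite (moebius_inversion (cexp mu ^~ h ^~ x)) cexpT. Qed.

Lemma hoeffding0 h x : hoeffding finset.set0 h x = fine (\int[M]_y (h y)%:E)%E.
Proof.
rewrite /hoeffding (big_pred1 finset.set0) => [|A]; last exact: finset.subset0.
by rewrite finset.setDv cards0 expr0 mul1r cexp0.
Qed.

Lemma hoeffding1 h k x : hoeffding [set k]%SET h x =
  cexp mu [set k]%SET h x - fine (\int[M]_y (h y)%:E)%E.
Proof.
rewrite /hoeffding (bigD1 [set k]%SET)//= finset.setDv cards0 expr0 mul1r.
congr (_ + _); rewrite (big_pred1 finset.set0) => [|A].
  by rewrite finset.setD0 cards1 expr1 mulN1r cexp0.
rewrite finset.subset1 /=; have [->|A0] := eqVneq A finset.set0.
  rewrite orbT/=; apply/negP => /eqP/finset.setP/(_ k).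
  by rewrite finset.in_set0 finset.in_set1 eqxx.
by rewrite orbF andbN.
Qed.

Section integrable.
Variable h : Omega -> R.
Hypothesis hi : M.-integrable setT (EFin \o h).

Let hoeffdingE (S : {set 'I_n}) : EFin \o hoeffding S h = fun x =>
  (\sum_(A : {set 'I_n} | A \subset S)
    ((-1) ^+ #|S :\: A|)%:E * (cexp mu A h x)%:E)%E.
Proof. by apply/funext => x; rewrite /= -sumEFin. Qed.

Lemma integrable_hoeffding (S : {set 'I_n}) :
  M.-integrable setT (EFin \o hoeffding S h).
Proof.
rewrite hoeffdingE; apply: integrable_sum => // A AS.
by apply: integrableZl => //; exact: integrable_cexp.
Qed.

Lemma measurable_hoeffding (S : {set 'I_n}) : measurable_fun setT (hoeffding S h).
Proof. by apply/measurable_EFinP; exact: measurable_int (integrable_hoeffding S). Qed.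

(** Adding [k] to [A] leaves the integral of [cexp mu A h] over [B] unchanged but flips the sign, so
    the terms cancel in pairs. This is condition (A2) in integrated form. *)
Lemma integral_hoeffding_degenerate (S : {set 'I_n}) k (B : set Omega) : k \in S ->
  measurable B -> depends_on (~: [set k])%SET B ->
  (\int[M]_(x in B) (hoeffding S h x)%:E = 0)%E.
Proof.
move=> kS mB kB.
have iB A : M.-integrable B (EFin \o cexp mu A h).
  by apply: (integrableS measurableT) => //; exact: integrable_cexp.
rewrite -[LHS]/(\int[M]_(x in B) (EFin \o hoeffding S h) x)%E hoeffdingE.
rewrite integral_sum//; last by move=> A; apply: integrableZl => //; exact: iB.
(* The integrals are finite, so the sum is moved to the reals, where [big_toggle] has the opposites
   it needs. *)
under eq_bigr => A _ do (rewrite integralZl ?(iB A)//;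
  rewrite -[X in (_ * X)%E]fineK ?integrable_fin_num ?(iB A)// -EFinM).
rewrite sumEFin; congr EFin.
apply: (@big_toggle _ _ k) => A kA.
  apply/idP/idP => [AS|AS].
    exact: (fintype.subset_trans (finset.subsetUr _ _) AS).
  by rewrite finset.subUset finset.sub1set kS.
move=> AS; rewrite (integral_cexpD1 hi _ mB kB); last exact: finset.setU11.
rewrite finset.setU1K// -mulNr; congr (_ * _).
rewrite [in RHS](finset.cardsD1 k) finset.in_setD kA kS exprS mulN1r opprK.
by rewrite finset.setDDl finset.setUC.
Qed.

(** Prescribing the marginals of [h] forces its conditional expectation given one coordinate to be 1
    almost everywhere. *)
Lemma hoeffding1_ae k : (\int[M]_x (h x)%:E = 1)%E ->
  (forall B : set mR, measurable B ->
    \int[M]_(x in coordinate k @^-1` B) (h x)%:E = mu k B)%E ->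
  {ae M, forall x, hoeffding [set k]%SET h x = 0}.
Proof.
move=> h1 hk; (* [cexp [set k] h] as a function of the [k]-th coordinate alone. *)
pose psi (t : mR) := cexp mu [set k]%SET h [tuple t | i < n].
have psiE x : psi (coordinate k x) = cexp mu [set k]%SET h x.
  apply: (@cexp_depends_on _ _ mu [set k]%SET) => i; rewrite finset.in_set1.
  by move=> /eqP ->; rewrite tnth_mktuple.
have mpsi : measurable_fun setT (EFin \o psi).
  apply/measurable_EFinP; apply: (measurableT_comp (measurable_cexp hi _)).
  apply/measurable_fun_tnthP => i.
  rewrite [X in measurable_fun _ X](_ : _ = id)//.
  by apply/funext => t; rewrite /= tnth_mktuple.
have ipsi : (mu k).-integrable setT (EFin \o psi).
  apply: (integrable_law_inv (@coordinate_law k)) => //.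
  rewrite [X in _.-integrable _ X](_ : _ = EFin \o cexp mu [set k]%SET h).
    exact: integrable_cexp.
  by apply/funext => x; rewrite /= psiE.
(* [psi] and the constant 1 have the same integral, [mu k E], over every Borel set [E]. *)
have : ae_eq (mu k) setT (EFin \o psi) (cst 1%E).
  apply: integral_ae_eq => // E _ mE.
  rewrite integral_cst// mul1e -[RHS](hk _ mE).
  rewrite -(integral_law (@coordinate_law k))//.
  have mE' := measurable_coordinate_preimage k mE.
  rewrite -(integral_cexp_depends_on hi (S := [set k]%SET))//.
    by apply: eq_integral => x _; rewrite /= psiE.
  by apply: coordinate_depends_on; rewrite finset.in_set1.
move=> /(ae_law (@coordinate_law k)); apply: filterS => x /= /(_ I)[].
by rewrite psiE hoeffding1 h1 => ->; rewrite subrr.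
Qed.

End integrable.

(** Lets a function on full vectors be read as a kernel in the variables listed by [i]. The default
    0 is harmless, since the projections used depend only on the coordinates in [i]. *)
Definition extend c (i : c.-tuple 'I_n) (y : c.-tuple mR) : Omega :=
  [tuple if [pick j | tnth i j == k] is Some j then tnth y j else 0 | k < n].

Lemma measurable_extend c (i : c.-tuple 'I_n) : measurable_fun setT (extend i).
Proof.
apply/measurable_fun_tnthP => k.
rewrite [X in measurable_fun _ X](_ : _ =
  (fun y => if [pick j | tnth i j == k] is Some j then tnth y j else 0)).
  by case: pickP => [j _|_]; [exact: measurable_tnth|exact: measurable_cst].
by apply/funext => y; rewrite /= tnth_mktuple.
Qed.

Lemma extend_restrict c (i : c.-tuple 'I_n) (x : Omega) k : k \in tval i ->
  tnth (extend i [tuple tnth x (tnth i j) | j < c]) k = tnth x k.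
Proof.
move=> /tnthP[j kj]; rewrite tnth_mktuple; case: pickP => [j' /eqP <-|].
  by rewrite tnth_mktuple.
by move=> /(_ j); rewrite -kj eqxx.
Qed.

Definition hoeffding_kernels (h : Omega -> R) : kernels R n :=
  fun c i y => hoeffding [set k in tval i]%SET h (extend i y).

Lemma hoeffding_kernelsE h c (i : c.-tuple 'I_n) x :
  hoeffding_kernels h i [tuple tnth x (tnth i j) | j < c] =
  hoeffding [set k in tval i]%SET h x.
Proof.
apply: hoeffding_depends_on => k; rewrite finset.in_set; exact: extend_restrict.
Qed.

Lemma Ustat_sum_hoeffding h x : Ustat_sum (hoeffding_kernels h) x =
  \sum_(S : {set 'I_n} | (1 < #|S|)%N) hoeffding S h x.
Proof.
rewrite -(sum_increasing (hoeffding ^~ h ^~ x)) /Ustat_sum.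
apply: eq_bigr => c _; apply: eq_bigr => i _; exact: hoeffding_kernelsE.
Qed.

End hoeffding.

(** * Random vectors *)

(** The density is nonnegative, so the positive and negative parts of the product are those of [f]
    times the density, and the nonnegative change of variables applies to each. *)
Lemma integral_density d (T : measurableType d) (R : realType)
    (nu : {finite_measure set T -> \bar R})
    (mu : {sigma_finite_measure set T -> \bar R}) (f : T -> R) :
  nu `<< mu -> measurable_fun setT f ->
  (\int[mu]_x (f x * fine (Radon_Nikodym_SigmaFinite.f nu mu x))%:E =
   \int[nu]_x (f x)%:E)%E.
Proof.
move=> numu mf; set h := fun x => fine (Radon_Nikodym_SigmaFinite.f nu mu x).
have hE x : Radon_Nikodym_SigmaFinite.f nu mu x = (h x)%:E.
  by rewrite /h fineK//; exact: Radon_Nikodym_SigmaFinite.f_fin_num.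
have h0 x : 0 <= h x by rewrite fine_ge0// Radon_Nikodym_SigmaFinite.f_ge0.
have mf' : measurable_fun setT (EFin \o f) by exact/measurable_EFinP.
rewrite integralE [RHS]integralE; congr (_ - _)%E.
- rewrite -(Radon_Nikodym_SigmaFinite.change_of_variables numu
    (funepos_ge0 (EFin \o f)) measurableT (measurable_funepos mf')).
  apply: eq_integral => x _; rewrite hE (funerpos (f \* h)) (funerpos f)/=.
  by rewrite -EFinM /funrpos maxr_pMl// mul0r.
- rewrite -(Radon_Nikodym_SigmaFinite.change_of_variables numu
    (funeneg_ge0 (EFin \o f)) measurableT (measurable_funeneg mf')).
  apply: eq_integral => x _; rewrite hE (funerneg (f \* h)) (funerneg f)/=.
  by rewrite -EFinM /funrneg maxr_pMl// mul0r mulNr.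
Qed.

Section vector_law.
Context d (T : measurableType d) (R : realType) (P : probability T R).
Local Notation mR := (measurableTypeR R).
Variable n : nat.

Lemma mvec_coordinate (X : 'I_n -> {mfun T >-> R}) k (B : set mR) :
  mvec X @^-1` (coordinate k @^-1` B) = X k @^-1` B.
Proof.
by apply/seteqP; split=> w; rewrite /coordinate /mvec /preimage/= tnth_mktuple.
Qed.

Lemma law_of_cdf (F : 'I_n -> cumulativeBounded (0 : R) (1 : R))
    (X : 'I_n -> {RV P >-> R}) :
  (forall k x, cdf (X k) x = (F k x)%:E) ->
  forall k (B : set mR), measurable B ->
    P (X k @^-1` B) = lebesgue_stieltjes_measure (F k) B.
Proof.
move=> XF k B mB; rewrite -mvec_coordinate.
(* Writing the law of [X k] as an image of the law of [mvec X] places it on [measurableTypeR R]. *)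
apply: (@lebesgue_stieltjes_cdf_unique R (F k)
  (distribution (distribution P (mvec X)) (coordinate k))) => // r.
by rewrite -XF /cdf /distribution /pushforward -(mvec_coordinate X k).
Qed.

Lemma integrable_expectation_exists (Y : T -> R) :
  P.-integrable setT (EFin \o Y) -> expectation_exists P Y.
Proof.
move=> iY; left; rewrite unlock.
have := integrable_lty measurableT (integrable_funepos measurableT iY).
by rewrite funerpos.
Qed.

Variables (mu : 'I_n -> probability mR R) (xi : 'I_n -> {RV P >-> R}).
Local Notation M := (product_probability mu).
Local Notation Omega := (n.-tuple mR).
Hypothesis law_xi : forall A, measurable A -> P (mvec xi @^-1` A) = M A.

Lemma vec_comp c (i : c.-tuple 'I_n) w :
  vec (fun j => xi (tnth i j)) w = [tuple tnth (mvec xi w) (tnth i j) | j < c].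
Proof. by apply: eq_from_tnth => j; rewrite !tnth_mktuple. Qed.

Lemma increasing_inj c (i : c.-tuple 'I_n) : increasing i -> injective (tnth i).
Proof.
move=> ii; apply/tuple_uniqP; rewrite -(map_inj_uniq val_inj).
exact: (sorted_uniq ltn_trans ltnn).
Qed.

(** The events of the required form make up a sigma-algebra, and it contains the generators: [i] is
    injective, so the remaining variables all have an index other than [tnth i k]. *)
Lemma omitted_sigma_algebra c (i : c.-tuple 'I_n) (k : 'I_c) A : increasing i ->
  g_sigma_preimage (fun j : 'I_c.-1 => xi (tnth i (lift k j))) A ->
  exists B : set Omega, [/\ measurable B,
    depends_on (~: [set tnth i k])%SET B & A = mvec xi @^-1` B].
Proof.
move=> ii; pose C := [set A | exists B : set Omega, [/\ measurable B,
  depends_on (~: [set tnth i k])%SET B & A = mvec xi @^-1` B]].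
suff : g_sigma_preimage (fun j : 'I_c.-1 => xi (tnth i (lift k j))) `<=` C by apply.
apply: smallest_sub; first split.
- by exists set0; split=> //; rewrite preimage_set0.
- move=> _ [B [mB kB ->]]; exists (~` B); split.
  + exact: measurableC.
  + by move=> x y xy; rewrite /setC/mkset (kB x y xy).
  + by rewrite setTD preimage_setC.
- move=> D /choice[B hB]; exists (\bigcup_j B j); split.
  + by apply: bigcupT_measurable => j; case: (hB j).
  + move=> x y xy; have Bxy j : B j x = B j y by case: (hB j) => _ + _; exact.
    by apply/propext; split=> -[j _ Bj]; exists j => //; [rewrite -Bxy|rewrite Bxy].
  + rewrite preimage_bigcup; apply: eq_bigcupr => j _; by case: (hB j).
- rewrite -bigcup_seq => D [j _ [Y mY]]; rewrite setTI => <-.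
  exists (coordinate (tnth i (lift k j)) @^-1` Y); split.
  + exact: measurable_coordinate_preimage.
  + apply: coordinate_depends_on; rewrite finset.in_setC finset.in_set1.
    by rewrite (inj_eq (increasing_inj ii)) eq_sym neq_lift.
  + by rewrite mvec_coordinate.
Qed.

Lemma calG_hoeffding (h : Omega -> R) :
  M.-integrable setT (EFin \o h) ->
  {ae M, forall x : Omega, -1 <= Ustat_sum (hoeffding_kernels mu h) x} ->
  calG xi (Ustat_sum (hoeffding_kernels mu h)).
Proof.
move=> hi hU; exists (hoeffding_kernels mu h) => //; split; last first.
  exact: (@ae_law _ _ _ _ R P M (mvec xi) law_xi
    (fun x => -1 <= Ustat_sum (hoeffding_kernels mu h) x) hU).
move=> c i c2n ii Z; set S := [set k in tval i]%SET.
have ZE : Z = hoeffding mu S h \o mvec xi.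
  by apply/funext => w; rewrite /Z/= vec_comp hoeffding_kernelsE.
have iZ : P.-integrable setT (EFin \o Z).
  by rewrite ZE; exact: (integrable_law law_xi (integrable_hoeffding hi S)).
split=> //.
  exact: (measurableT_comp (measurable_hoeffding hi S) (measurable_extend i)).
move=> k; split => //.
- exact: finite_measure_integrable_cst.
(* A constant has only [setT] and [set0] as preimages, and both lie in the sigma-algebra. *)
- move=> B mB; rewrite preimage_cst; case: ifP => _.
    have [g0 gC _] := smallest_sigma_algebra setT
      (\big[setU/set0]_(j < c.-1) preimage_set_system setT
        (xi (tnth i (lift k j))) measurable).
    by rewrite -[setT]setD0; exact: gC.
  exact: sigma_algebra0.
- move=> A /(omitted_sigma_algebra ii)[B [mB kB ->]].
  rewrite integral0 ZE.
  rewrite (integral_law law_xi (f := EFin \o hoeffding mu S h))//; last first.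
    exact: measurable_int (integrable_hoeffding hi S).
  rewrite (integral_hoeffding_degenerate hi (k := tnth i k))//.
  by rewrite finset.in_set mem_tnth.
Qed.

End vector_law.

(** * The decomposition of a density, and integrals of degenerate kernels over coordinate events *)

Section representation.
Context {R : realType}.
Local Notation mR := (measurableTypeR R).
Variables (n : nat) (mu : 'I_n -> probability mR R).
Local Notation Omega := (n.-tuple mR).
Local Notation M := (product_probability mu).

Lemma Ustat_sum_hoeffding_ae (h : Omega -> R) :
  M.-integrable setT (EFin \o h) ->
  (forall k (B : set mR), measurable B ->
    \int[M]_(x in coordinate k @^-1` B) (h x)%:E = mu k B)%E ->
  (\int[M]_x (h x)%:E = 1)%E ->
  {ae M, forall x : Omega, 1 + Ustat_sum (hoeffding_kernels mu h) x = h x}.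
Proof.
move=> hi hk h1.
(* Finitely many exceptional null sets, one for each [k], are merged into one. *)
have : {ae M, forall x, forall k, hoeffding mu [set k]%SET h x = 0}.
  by apply: filter_forall => k; apply: hoeffding1_ae => //; exact: hk.
apply: filterS => x x0; rewrite Ustat_sum_hoeffding -[RHS](sum_hoeffding mu).
rewrite [RHS](bigID (fun S : {set 'I_n} => (1 < #|S|)%N))/= addrC; congr (_ + _).
rewrite (bigD1 finset.set0)/=; last by rewrite cards0.
rewrite hoeffding0 h1/= big1 ?addr0// => S /andP[]; rewrite -leqNgt => S1 S0.
have /cards1P[k ->] : #|S| == 1%N by rewrite eqn_leq S1 finset.card_gt0.
exact: x0.
Qed.

Variables (d : measure_display) (T : measurableType d) (P : probability T R).
Variable xi : 'I_n -> {RV P >-> R}.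
Hypothesis law_xi : forall A, measurable A -> P (mvec xi @^-1` A) = M A.

Lemma integral_kernel c (i : c.-tuple 'I_n) (g : c.-tuple R -> R) (k : 'I_n)
    (B : set mR) :
  let Z := g \o vec (fun j => xi (tnth i j)) in
  (1 < c)%N -> increasing i -> measurable_fun setT g ->
  P.-integrable setT (EFin \o Z) ->
  (forall j : 'I_c, is_cond_expectation P
    (g_sigma_preimage (fun l : 'I_c.-1 => xi (tnth i (lift j l)))) Z (cst 0)) ->
  measurable B -> (\int[P]_(w in xi k @^-1` B) (Z w)%:E = 0)%E.
Proof.
case: c i g => [|[|c]]// i g Z _ ii mg iZ gZ mB.
have Z0 (j : 'I_c.+2) A :
    g_sigma_preimage (fun l : 'I_c.+1 => xi (tnth i (lift j l))) A ->
    (\int[P]_(w in A) (Z w)%:E = 0)%E.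
  by case: (gZ j) => _ _ _ ZA /ZA <-; rewrite integral0.
have [/tnthP[j ->]|ki] := boolP (k \in tval i).
  (* [lift j ord0] is a position other than [j], available because the kernel has at least two
     arguments. Omitting it keeps [xi k] among the conditioning variables. *)
  have [l jl] : exists l, j = lift (lift j ord0) l.
    by case: (unliftP (lift j ord0) j) => [l jl|/eqP]; [exists l|rewrite (negbTE (neq_lift _ _))].
  apply: (Z0 (lift j ord0)); apply: sub_sigma_algebra; rewrite -bigcup_seq.
  exists l; first by rewrite /= mem_index_enum.
  by exists B => //; rewrite setTI -jl.
(* Here [k] is not among the indices, so [Z] is a function [G] of coordinates other than the [k]-th
   and the integral factorizes. *)
pose G (x : Omega) := g [tuple tnth x (tnth i j) | j < c.+2].
have ZE : Z = G \o mvec xi by apply/funext => w; rewrite /Z/= vec_comp.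
have mG : measurable_fun setT G.
  apply: (measurableT_comp mg); apply/measurable_fun_tnthP => j.
  rewrite [X in measurable_fun _ X](_ : _ = fun x : Omega => tnth x (tnth i j)).
    exact: measurable_tnth.
  by apply/funext => x; rewrite /= tnth_mktuple.
have mG' : measurable_fun setT (EFin \o G) by exact/measurable_EFinP.
rewrite -mvec_coordinate ZE (integral_law law_xi (f := EFin \o G))//; last first.
  exact: measurable_coordinate_preimage.
rewrite integral_independent//.
- rewrite -(integral_law law_xi (f := EFin \o G))// preimage_setT.
  rewrite -[X in (_ * X)%E]/(\int[P]_w ((G \o mvec xi) w)%:E)%E -ZE.
  (* The second factor is the full expectation of [Z], which vanishes because [setT] is a
     conditioning event. *)
  rewrite (Z0 ord0) ?mule0//.
  have [g0 gC _] := smallest_sigma_algebra setT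
    (\big[setU/set0]_(l < c.+1) preimage_set_system setT
      (xi (tnth i (lift ord0 l))) measurable).
  by rewrite -[setT]setD0; exact: gC.
- by apply: (integrable_law_inv law_xi) => //; move: iZ; rewrite ZE.
- move=> x y xy; congr g; apply: eq_from_tnth => j; rewrite !tnth_mktuple.
  apply: xy; rewrite finset.in_setC finset.in_set1.
  by apply: contra ki => /eqP <-; exact: mem_tnth.
Qed.

(** Integrability and vanishing are carried together through the sums, since additivity of the
    integral rests on integrability of the terms. *)
Lemma integral_Ustat_sum U (k : 'I_n) (B : set mR) : calG xi U -> measurable B ->
  P.-integrable setT (EFin \o U \o vec xi) /\
  (\int[P]_(w in xi k @^-1` B) (U (vec xi w))%:E = 0)%E.
Proof.
move=> [g [hg _] ->] mB; set A := xi k @^-1` B.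
have mA : measurable A by rewrite -[A]setTI; exact: measurable_funP.
pose null f := P.-integrable setT (EFin \o f) /\ (\int[P]_(w in A) (f w)%:E = 0)%E.
have null_sum (I : eqType) (s : seq I) (p : pred I) (f : I -> T -> R) :
    (forall i, i \in s -> p i -> null (f i)) ->
    null (fun w => \sum_(i <- s | p i) f i w).
  elim: s => [_|i s IH nf].
    under eq_fun do rewrite big_nil.
    by split; [exact: finite_measure_integrable_cst|rewrite integral0].
  have {}IH : null (fun w => \sum_(i <- s | p i) f i w).
    by apply: IH => j js; apply: nf; rewrite in_cons js orbT.
  under eq_fun do rewrite big_cons.
  case: (boolP (p i)) => [pi|_]; last exact: IH.
  have [i1 i2] := IH; have [f1 f2] := nf i (mem_head _ _) pi.
  split; first exact: (integrableD measurableT f1 i1).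
  under eq_integral do rewrite EFinD.
  rewrite integralD//; try exact: (integrableS measurableT).
  by rewrite f2 i2 adde0.
rewrite /Ustat_sum; apply: (null_sum) => c; rewrite mem_index_iota ltnS => c2n _.
apply: (null_sum) => i _ ii; have [mg iZ gZ] := hg c i c2n ii.
have -> : (fun w => g c i [tuple tnth (vec xi w) (tnth i j) | j < c]) =
    g c i \o vec (fun j => xi (tnth i j)).
  by apply/funext => w; rewrite /= vec_comp.
split=> //; apply: integral_kernel => //.
by case/andP: c2n.
Qed.

End representation.

Lemma integrable_fine_density d (T : measurableType d) (R : realType)
    (nu : {finite_measure set T -> \bar R})
    (mu : {sigma_finite_measure set T -> \bar R}) :
  nu `<< mu -> mu.-integrable setT
    (EFin \o (fun x => fine (Radon_Nikodym_SigmaFinite.f nu mu x))).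
Proof.
move=> numu; rewrite (_ : EFin \o _ = Radon_Nikodym_SigmaFinite.f nu mu).
  exact: Radon_Nikodym_SigmaFinite.f_integrable.
by apply/funext => x; rewrite /= fineK// Radon_Nikodym_SigmaFinite.f_fin_num.
Qed.

(** * The two implications *)

Section density.
Context {R : realType}.
Local Notation mR := (measurableTypeR R).
Variables (n : nat) (mu : 'I_n -> probability mR R).
Local Notation M := (product_probability mu).
Variables (d : measure_display) (T : measurableType d) (P : probability T R).
Variable xi : 'I_n -> {RV P >-> R}.
Hypothesis law_xi : forall A, measurable A -> P (mvec xi @^-1` A) = M A.
Variables (d' : measure_display) (T' : measurableType d') (Q : probability T' R).
Variable X : 'I_n -> {RV Q >-> R}.
Hypothesis law1_X : forall k (B : set mR), measurable B ->
  Q (X k @^-1` B) = mu k B.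
Hypothesis X_ac : pushforward Q (vec X) `<< M.

Lemma calG_density : exists2 U : n.-tuple R -> R, calG xi U &
  forall f : n.-tuple R -> R, measurable_fun setT f ->
    expectation_exists Q (f \o vec X) ->
    expectation_exists P (fun w => f (vec xi w) * (1 + U (vec xi w))) ->
    'E_Q[f \o vec X]%E = 'E_P[fun w => (f (vec xi w) * (1 + U (vec xi w)))%R]%E.
Proof.
pose nu : probability (n.-tuple (measurableTypeR R)) R := distribution Q (mvec X).
have nuM : nu `<< M by exact: X_ac.
pose h x := fine (Radon_Nikodym_SigmaFinite.f nu M x).
have hi : M.-integrable setT (EFin \o h) by exact: integrable_fine_density.
have mh : measurable_fun setT h by apply/measurable_EFinP; exact: measurable_int hi.
have hB B : measurable B -> (\int[M]_(x in B) (h x)%:E = nu B)%E.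
  move=> mB; rewrite (Radon_Nikodym_SigmaFinite.f_integral nuM)//.
  apply: eq_integral => x _.
  by rewrite /h fineK// Radon_Nikodym_SigmaFinite.f_fin_num.
pose U := Ustat_sum (hoeffding_kernels mu h).
have hU : {ae M, forall x : n.-tuple mR, 1 + U x = h x}.
  apply: Ustat_sum_hoeffding_ae => //.
    move=> k B mB; rewrite hB; last exact: measurable_coordinate_preimage.
    by rewrite -law1_X// -mvec_coordinate.
  by rewrite hB// probability_setT.
exists U; first apply: calG_hoeffding => //.
  (* Condition (A3): [1 + U] agrees almost everywhere with a nonnegative density. *)
  move: hU; apply: filterS => x Ux; rewrite -subr_ge0 opprK addrC -/U Ux.
  by rewrite fine_ge0// Radon_Nikodym_SigmaFinite.f_ge0.
move=> f mf _ _; rewrite unlock.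
have mf' : @measurable_fun _ _ (n.-tuple (measurableTypeR R)) _ setT f by exact: mf.
have mU : @measurable_fun _ _ (n.-tuple (measurableTypeR R)) _ setT U.
  rewrite (_ : U = fun x => \sum_(S : {set 'I_n})
      (if (1 < #|S|)%N then hoeffding mu S h x else 0)); last first.
    by apply/funext => x; rewrite /U Ustat_sum_hoeffding [LHS]big_mkcond.
  apply: measurable_sum => S; case: (1 < #|S|)%N; last exact: measurable_cst.
  exact: measurable_hoeffding.
(* The expectation of [f] is carried to the law [nu] of the vector, then to [M] through the density
   [h]; there [h] is replaced by [1 + U], and the integral is pulled back along [mvec xi]. *)
transitivity (\int[nu]_x (f x)%:E)%E.
  rewrite -[RHS](integral_law (m := Q) (phi := mvec X))//.
  exact/measurable_EFinP.
rewrite -(integral_density nuM mf').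
transitivity (\int[M]_x (f x * (1 + U x))%:E)%E.
  apply: ae_eq_integral => //.
  - by apply/measurable_EFinP; exact: measurable_funM.
  - apply/measurable_EFinP; apply: measurable_funM => //.
    by apply: measurable_funD => //; exact: measurable_cst.
  - by move: hU; apply: filterS => x -> _.
rewrite -(integral_law law_xi (f := fun x => (f x * (1 + U x))%:E))//.
apply/measurable_EFinP; apply: measurable_funM => //.
by apply: measurable_funD => //; exact: measurable_cst.
Qed.

Lemma law_of_calG (U : n.-tuple R -> R) : calG xi U ->
  (forall f : n.-tuple R -> R, measurable_fun setT f ->
    expectation_exists Q (f \o vec X) ->
    expectation_exists P (fun w => f (vec xi w) * (1 + U (vec xi w))) ->
    'E_Q[f \o vec X]%E = 'E_P[fun w => (f (vec xi w) * (1 + U (vec xi w)))%R]%E) ->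
  forall k (B : set mR), measurable B -> Q (X k @^-1` B) = P (xi k @^-1` B).
Proof.
move=> GU UE k B mB.
have mX : measurable (X k @^-1` B).
  by rewrite -[_ @^-1` _]setTI; exact: (measurable_funP (X k)).
have mxi : measurable (xi k @^-1` B).
  by rewrite -[_ @^-1` _]setTI; exact: (measurable_funP (xi k)).
pose f : n.-tuple R -> R := \1_(coordinate k @^-1` B).
have fX : f \o vec X = \1_(X k @^-1` B) by rewrite -(mvec_coordinate X).
have [iU U0] := integral_Ustat_sum law_xi k GU mB.
pose V w := 1 + U (vec xi w).
have i1 : P.-integrable setT (EFin \o cst 1) by exact: finite_measure_integrable_cst.
have iV : P.-integrable setT (EFin \o V) by exact: (integrableD measurableT i1 iU).
pose Y w := f (vec xi w) * V w.
(* As [f] is an indicator, the right-hand expectation becomes the integral of [1 + U] over the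
   event, where the [U] part contributes 0. *)
have YE : EFin \o Y = (EFin \o V) \_ (xi k @^-1` B).
  apply/funext => w; rewrite patchE -(mvec_coordinate xi) /Y /f/= indicE.
  rewrite -[w \in _]/(mvec xi w \in coordinate k @^-1` B).
  by case: (_ \in _); rewrite ?mul1r ?mul0r.
have iY : P.-integrable setT (EFin \o Y).
  by rewrite YE; apply: (integrable_mkcond _ mxi).1; exact: (integrableS measurableT).
have mf : measurable_fun setT f.
  exact: (measurable_indic (measurable_coordinate_preimage k mB)).
have iX : Q.-integrable setT (EFin \o (f \o vec X)).
  by rewrite fX; exact: integrable_indic.
(* Integrability of both sides supplies the two existence conditions of the representation. *)
have := UE f mf (integrable_expectation_exists iX) (integrable_expectation_exists iY).
rewrite unlock fX integral_indic// setIT => ->.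
rewrite -[LHS]/(\int[P]_w (EFin \o Y) w)%E YE -integral_mkcond.
under eq_integral do rewrite /= EFinD.
rewrite integralD//; try exact: (integrableS measurableT).
by rewrite U0 adde0 integral_cst// mul1e.
Qed.

End density.

Theorem theorem4p1 (R : realType) (n : nat) (hn : (2 <= n)%N)
  (F : 'I_n -> cumulativeBounded (0 : R) (1 : R))
  (d : measure_display) (T : measurableType d) (P : probability T R)
  (xi : 'I_n -> {RV P >-> R})
  (xi_indep : mutually_independent xi)
  (xi_cdf : forall (k : 'I_n) (x : R), cdf (xi k) x = (F k x)%:E)
  (d' : measure_display) (T' : measurableType d') (Q : probability T' R)
  (X : 'I_n -> {RV Q >-> R})
  (X_ac : pushforward Q (vec X) `<<
    product_probability (fun k => lebesgue_stieltjes_measure (F k))) :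
  (forall (k : 'I_n) (x : R), cdf (X k) x = (F k x)%:E) <->
  exists2 U : n.-tuple R -> R, calG xi U &
    forall f : n.-tuple R -> R, measurable_fun setT f ->
      expectation_exists Q (f \o vec X) ->
      expectation_exists P (fun w => f (vec xi w) * (1 + U (vec xi w))) ->
      'E_Q[f \o vec X]%E =
      'E_P[fun w => (f (vec xi w) * (1 + U (vec xi w)))%R]%E.
Proof.
(* The bounds 0 and 1 of [F k] make its Lebesgue-Stieltjes measure a probability. *)
pose mu k : probability (measurableTypeR R) R := lebesgue_stieltjes_measure (F k).
pose M := product_probability mu.
have law1_xi k B : measurable B -> P (xi k @^-1` B) = mu k B.
  by move=> mB; exact: law_of_cdf.
have law_xi A : measurable A -> P (mvec xi @^-1` A) = M A.
  exact: (independent_law xi_indep).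
split=> [X_cdf|[U GU UE] k t].
- have law1_X k B : measurable B -> Q (X k @^-1` B) = mu k B.
    by move=> mB; exact: law_of_cdf.
  exact: (calG_density law_xi law1_X X_ac).
- rewrite -xi_cdf; exact: (law_of_calG law_xi GU UE k (measurable_itv `]-oo, t])).
Qed.
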